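(* Let $n\ge2$, let $c,u_1,\dots,u_n,v_1,\dots,v_n$ be complex parameters in general position, and let $f$ be a function of one variable. Then \begin{align*} &\mathrm{Sym}_c\Bigg((1-\theta)^{n-1}\prod_{j=2}^n\prod_{k=1}^n(u_j-v_k)\,f(u_1)\Bigg)\\ =&(n-1)!\,(-c)^{n-1}\,\frac{\prod_{i=1}^n\prod_{k=1}^n(v_i-u_k)(v_i-u_k-c)}{\prod_{1\le i<j\le n}(v_j-v_i)\prod_{1\le i<j\le n}(u_i-u_j)}\,\det_{1\le j,k\le n}\Bigg(\frac{1}{(v_j-u_k)(v_j-u_k-c)}\Bigg)\,\partial_{n-1}\cdots\partial_1f(u_1). \end{align*}
   Context: For a function $g(u_1,\dots,u_n)$, the divided difference operators $\partial_k$, $k=1,\dots,n-1$, are $$\partial_kg(u_1,\dots,u_n)=\frac{g(u_1,\dots,u_k,u_{k+1},\dots,u_n)-g(u_1,\dots,u_{k+1},u_k,\dots,u_n)}{u_k-u_{k+1}};$$ in $\partial_{n-1}\cdots\partial_1f(u_1)$ the operator $\partial_1$ is applied first, to $f(u_1)$ regarded as a function of $u_1,\dots,u_n$. The symmetrization is $\mathrm{Sym}_c(g(u_1,\dots,u_n)):=\sum_{w\in S_n}w\cdot\big(\Delta(1,2,\dots,n)\,g(u_1,\dots,u_n)\big)$, where $S_n$ acts by permuting the variables $u_1,\dots,u_n$ ($w$ replaces $u_i$ by $u_{w(i)}$) and $\Delta(k_1,\dots,k_n):=\prod_{1\le i<j\le n}\frac{u_{k_i}-u_{k_j}-c}{u_{k_i}-u_{k_j}}$.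 The operator $\theta$ shifts the index of the $u$-variables: $\theta u_k:=u_{k+1}$ with the convention $u_{k+n}:=u_k+c$. It acts on functions by substitution in all $u$-variables (so $\theta g(u_1,\dots,u_n)=g(u_2,\dots,u_n,u_1+c)$), and $(1-\theta)^{n-1}=\sum_{\ell=0}^{n-1}(-1)^\ell\binom{n-1}{\ell}\theta^\ell$ acts on the whole product $\prod_{j=2}^n\prod_{k=1}^n(u_j-v_k)\,f(u_1)$. ''In general position'' means that zeros of all factors in denominators are avoided. *)

(* Defs.v *)
From HB Require Import structures.
From mathcomp Require Export all_boot all_order all_algebra all_fingroup.
From mathcomp Require Export reals.
From mathcomp Require Export complex.

Set Implicit Arguments.
Unset Strict Implicit.
Unset Printing Implicit Defensive.

Import GRing.Theory.
Local Open Scope ring_scope.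

(* A function g(u_1, ..., u_n) is a map on points u : {ffun 'I_n -> F}; the
   variable u_k is u i with i : 'I_n of value k - 1.  An operator on functions
   sends g to a new function, given by its value at each point u. *)

Definition permute_vars (F : fieldType) (n : nat) (w : 'S_n)
    (g : {ffun 'I_n -> F} -> F) (u : {ffun 'I_n -> F}) : F :=
  g [ffun i => u (w i)].

(* [ordS k] is the cyclic successor of k; since it wraps around at the last
   index, [divdiff k] is the divided difference of adjacent variables only for
   k.+1 < n. *)
Definition divdiff (F : fieldType) (n : nat) (k : 'I_n)
    (g : {ffun 'I_n -> F} -> F) (u : {ffun 'I_n -> F}) : F :=
  (g u - permute_vars (tperm k (ordS k)) g u) / (u k - u (ordS k)).

(* The composite of all the n - 1 divided differences; [foldl] runs through
   the indices in increasing order, so the one at index 0 is applied first. *)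
Definition divdiffs (F : fieldType) (n : nat)
    (g : {ffun 'I_n -> F} -> F) : {ffun 'I_n -> F} -> F :=
  foldl (fun h k => divdiff k h) g [seq k : 'I_n <- enum 'I_n | (k.+1 < n)%N].

Definition Delta (F : fieldType) (n : nat) (c : F) (u : {ffun 'I_n -> F}) : F :=
  \prod_(i < n) \prod_(j < n | (i < j)%N) ((u i - u j - c) / (u i - u j)).

Definition Sym (F : fieldType) (n : nat) (c : F)
    (g : {ffun 'I_n -> F} -> F) (u : {ffun 'I_n -> F}) : F :=
  \sum_(w : 'S_n) permute_vars w (fun x => Delta c x * g x) u.

Definition theta (F : fieldType) (n : nat) (c : F)
    (g : {ffun 'I_n -> F} -> F) (u : {ffun 'I_n -> F}) : F :=
  g [ffun i : 'I_n => if i.+1 == n then u (ordS i) + c else u (ordS i)].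

Definition one_sub_theta (F : fieldType) (n : nat) (c : F)
    (g : {ffun 'I_n -> F} -> F) (u : {ffun 'I_n -> F}) : F :=
  g u - theta c g u.

(* Main.v *)
Require Import Defs.
From mathcomp Require Import ring.
Set Implicit Arguments.
Unset Strict Implicit.
Unset Printing Implicit Defensive.
Import GRing.Theory.
Local Open Scope ring_scope.

(** Write P(x) = prod_k (x - v_k), d(s,t) = (u_s - u_t - c)/(u_s - u_t), and
[n] for the index set.  Both sides are linear combinations of the values
f(u_m), and the theorem is proved by comparing the coefficients of f(u_m).

On the right, the iterated divided difference has Newton's closed form
sum_m f(u_m) / prod_(k != m) (u_m - u_k) ([divdiffs_newton]).

On the left, theta^l turns the product into f at position l, with the weight
P(x + c) at the l positions before it and P(x) at those after it.  Summing over
the permutations that keep the set I of indices placed before position l, the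
order inside I contributes only l!, because
sum_(s in S) prod_(t in S, t != s) d(s,t) = |S| for every S, an identity read
off the leading coefficient in a Lagrange interpolation
([sum_prod_shifted_ratio]); likewise the order after position l contributes
(n-1-l)!.  These factorials absorb the binomial coefficients of
(1 - theta)^(n-1) into (n-1)!, and f(u_m) is left with a signed sum B_m over the
subsets I of [n] that avoid m ([Sym_iter_one_sub_theta]).

It remains to evaluate B_m.  A shift of the variables outside I by c multiplies
the Vandermonde product by prod_(i in I, j notin I) d(i,j), so B_m is, up to
Vandermonde factors, the expansion of one n x n determinant
([det_marked_mx]).  For k != m, its k-th row evaluates on the polynomials
q = (x - u_m) x^a the functional
L_k(q) = q(u_k + c) P(u_k) - q(u_k) P(u_k + c),
while L_m on them gives c P(u_m) times its m-th row.  The L_k kill P, hence on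
polynomials of degree at most n they depend only on the values q(v_j), and
Lagrange interpolation at the v_j factors (L_k(q_a)) as
(L_k on the Lagrange basis) times (values at v_j).  The first factor is the matrix
1/((v_j - u_k)(v_j - u_k - c)) up to row scalings, and the second is a scaled
Vandermonde matrix ([det_marked_mx_cauchy]).  The factor P(u_m), which is not
zero, cancels, and the rest does not depend on m except through
prod_(k != m) (u_m - u_k) ([marked_subset_sum_det]). *)

(** * Interpolation at the points of a finite set *)

Section Interpolation.

Variables (F : fieldType) (T : finType) (u : T -> F) (S : {set T}).
Hypothesis u_inj : {in S &, injective u}.

Lemma lagrange_interpolation (q : {poly F}) : (size q <= #|S|)%N ->
  q = \sum_(s in S) (q.[u s] / \prod_(t in S :\ s) (u s - u t))
                      *: \prod_(t in S :\ s) ('X - (u t)%:P).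
Proof.
move=> sz_q; apply/eqP; rewrite -subr_eq0; set r := q - _.
have sz_basis s : s \in S -> size (\prod_(t in S :\ s) ('X - (u t)%:P)) = #|S|.
  move=> Ss; rewrite -big_enum size_prod_XsubC -cardE.
  by rewrite (cardsD1 s S) Ss.
have sz_r : (size r <= #|S|)%N.
  rewrite (leq_trans (size_polyD _ _)) // geq_max sz_q size_polyN.
  rewrite (leq_trans (size_sum _ _ _)) //; apply/bigmax_leqP => s Ss.
  by rewrite (leq_trans (size_scale_leq _ _)) // sz_basis.
apply: contraTT sz_r => r_neq0; rewrite -ltnNge cardE.
have <- : size [seq u s | s <- enum S] = size (enum S) by rewrite size_map.
apply: max_poly_roots r_neq0 _ _; last first.
  rewrite map_inj_in_uniq ?enum_uniq // => s t.
  by rewrite !mem_enum; apply: u_inj.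
apply/allP => y /mapP[s]; rewrite mem_enum => Ss ->.
rewrite /root hornerD hornerN horner_sum (big_setD1 s) //=.
have horner_basis t x : (\prod_(z in S :\ t) ('X - (u z)%:P)).[x]
    = \prod_(z in S :\ t) (x - u z).
  by rewrite horner_prod; apply: eq_bigr => z _; rewrite hornerXsubC.
rewrite hornerZ horner_basis divfK; last first.
  apply/prodf_neq0 => t; rewrite !inE => /andP[t_neq_s St].
  by rewrite subr_eq0; apply: contraNneq t_neq_s => /u_inj ->.
rewrite big1 ?addr0 ?subrr // => t; rewrite !inE => /andP[t_neq_s St].
rewrite hornerZ horner_basis [X in _ * X](big_setD1 s) /=; last first.
  by rewrite !inE eq_sym t_neq_s.
by rewrite subrr mul0r mulr0.
Qed.

(** The difference prod_t (x - u_t - c) - prod_t (x - u_t) takes the value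
-c prod_(t != s) (u_s - u_t - c) at u_s; the identity, multiplied by -c, compares
its coefficient of degree |S| - 1 with that of its Lagrange interpolant. *)
Lemma sum_prod_shifted_ratio (c : F) :
  \sum_(s in S) \prod_(t in S :\ s) ((u s - u t - c) / (u s - u t)) = #|S|%:R.
Proof.
have u_neq s t : s \in S -> t \in S :\ s -> u s - u t != 0.
  move=> Ss; rewrite !inE => /andP[t_neq_s St].
  by rewrite subr_eq0; apply: contraNneq t_neq_s => /u_inj ->.
have [-> | c_neq0] := eqVneq c 0.
  rewrite -sum1_card natr_sum; apply: eq_bigr => s Ss.
  by rewrite big1 // => t /(u_neq s t Ss) ust; rewrite subr0 divff.
have [S0 | [s0 Ss0]] := set_0Vmem S; first by rewrite S0 big_set0 cards0.
have S_gt0 : (0 < #|S|)%N by apply/card_gt0P; exists s0.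
pose sh a := \prod_(t in S) ('X - (u t + a)%:P).
have shE a : sh a = \prod_(x <- [seq u t + a | t <- enum S]) ('X - x%:P).
  by rewrite big_map big_enum.
have sz_map a : size [seq u t + a | t <- enum S] = #|S|.
  by rewrite size_map cardE.
have sz_sh a : size (sh a) = #|S|.+1.
  by rewrite shE -[RHS](congr1 succn (sz_map a)) size_prod_XsubC.
have coef_sh a : (sh a)`_#|S|.-1 = - \sum_(t in S) (u t + a).
  rewrite shE -(sz_map a) coefPn_prod_XsubC ?sz_map -?lt0n //.
  by rewrite big_map big_enum.
have mon_sh a : sh a \is monic by apply: monic_prod_XsubC.
pose q := sh c - sh 0.
have sz_q : (size q <= #|S|)%N.
  apply/leq_sizeP => j; rewrite leq_eqVlt => /predU1P[<- | lt_j].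
    have lead a : (sh a)`_#|S| = 1.
      by have /monicP := mon_sh a; rewrite lead_coefE sz_sh.
    by rewrite coefB !lead subrr.
  by rewrite coefB !nth_default ?subrr // sz_sh.
have q_u s : s \in S -> q.[u s] = - c * \prod_(t in S :\ s) (u s - u t - c).
  move=> Ss; rewrite hornerD hornerN !horner_prod !(big_setD1 s Ss) /=.
  rewrite !hornerXsubC addr0 subrr mul0r subr0; congr (_ * _).
    by rewrite opprD addrA subrr sub0r.
  by apply: eq_bigr => t _; rewrite hornerXsubC opprD addrA.
have /(congr1 (fun p : {poly F} => p`_#|S|.-1)) := lagrange_interpolation sz_q.
rewrite coefB !coef_sh coef_sum opprK addrC -sumrB.
under eq_bigr do rewrite addr0 opprD addrA subrr add0r.
rewrite sumr_const => eq_c.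
apply: (mulfI (_ : - c != 0)); first by rewrite oppr_eq0.
rewrite mulr_natr eq_c mulr_sumr; apply: eq_bigr => s Ss.
have lead : (\prod_(t in S :\ s) ('X - (u t)%:P))`_#|S|.-1 = 1.
  have sz : size (\prod_(t in S :\ s) ('X - (u t)%:P)) = #|S|.
    by rewrite -big_enum size_prod_XsubC -cardE (cardsD1 s S) Ss.
  by rewrite -sz -lead_coefE; apply/monicP/monic_prod_XsubC.
by rewrite coefZ lead mulr1 q_u // prodf_div mulrA.
Qed.

End Interpolation.

(** * Sums over the orderings of a finite set *)

Section Orderings.

Variables (F : comPzRingType) (T : finType) (d : T -> T -> F).

(** The sum, over the orderings s_0, s_1, ... of S, of
prod_(i < j) d(s_i,s_j) prod_i phi_i(s_i), in the recursive form obtained by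
summing over the first element; the list of weights is meant to have length
#|S|. *)
Fixpoint ordering_sum (phis : seq (T -> F)) (S : {set T}) : F :=
  if phis is phi :: phis' then
    \sum_(s in S) phi s * (\prod_(t in S :\ s) d s t)
                  * ordering_sum phis' (S :\ s)
  else 1.

(** Sum first over the image s of 0.  The injection g is what makes the induction
work: the remaining entries are those of g composed with [lift s]. *)
Lemma sum_perm_ordering (n : nat) (g : 'I_n -> T) (phis : seq (T -> F)) :
  injective g -> size phis = n ->
  \sum_(w : 'S_n)
     (\prod_(i < n) \prod_(j < n | (i < j)%N) d (g (w i)) (g (w j)))
     * \prod_(i < n) nth (fun=> 1) phis i (g (w i))
  = ordering_sum phis [set g i | i in 'I_n].
Proof.
elim: phis n g => [|phi phis IH] [|n] //= g g_inj => [_ | [sz_phis]].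
  under eq_bigr do rewrite !big_ord0 mulr1.
  by rewrite sumr_const card_Sn.
rewrite big_imset /=; last by move=> i j _ _ /g_inj.
rewrite (partition_big (fun w : 'S_n.+1 => w ord0) predT) //=.
apply: eq_bigr => s _.
have gs_inj : injective (g \o lift s) by apply: inj_comp g_inj lift_inj.
have imD1 : [set g i | i in 'I_n.+1] :\ g s
            = [set (g \o lift s) i | i in 'I_n].
  apply/setP => x; rewrite !inE; apply/andP/imsetP => [[x_neq] | [i _ ->]].
    case/imsetP => i _ xE; rewrite xE in x_neq *.
    case: (unliftP s i) x_neq => [j -> _ | ->]; last by rewrite eqxx.
    by exists j.
  rewrite (inj_eq g_inj) eq_sym neq_lift; split=> //.
  by apply/imsetP; exists (lift s i).
rewrite imD1 -IH // big_imset /=; last by move=> i j _ _ /gs_inj.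
(* a permutation sending 0 to s is an arbitrary permutation of the rest *)
rewrite (reindex (lift_perm ord0 s)); last first.
  pose ulsf (w : 'S_n.+1) k := odflt k (unlift (w ord0) (w (lift ord0 k))).
  have ulsfK (w : 'S_n.+1) k : lift (w ord0) (ulsf w k) = w (lift ord0 k).
    rewrite /ulsf; have := neq_lift ord0 k.
    by rewrite -(inj_eq (@perm_inj _ w)) => /unlift_some[] ? ? ->.
  have ulsf_inj w : injective (ulsf w).
    move=> i j eq_ij; apply: (@lift_inj _ ord0); apply: (@perm_inj _ w).
    by rewrite -!ulsfK eq_ij.
  exists (fun w => perm (ulsf_inj w)) => [w _ | w].
    by apply/permP => k; rewrite permE /ulsf lift_perm_lift lift_perm_id liftK.
  move=> /eqP ws; apply/permP => k.
  case: (unliftP ord0 k) => [j|] ->; rewrite ?lift_perm_id //.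
  by rewrite lift_perm_lift -ws permE ulsfK.
rewrite mulr_sumr; apply: eq_big => [w | w _]; first by rewrite lift_perm_id eqxx.
rewrite !big_ord_recl /= lift_perm_id big_mkcond big_ord_recl /= mul1r.
rewrite mulrCA -!mulrA; congr (_ * _); congr (_ * _).
  rewrite [RHS](reindex_inj (@perm_inj _ w)) /=.
  by apply: eq_bigr => j _; rewrite lift_perm_lift.
congr (_ * _); apply: eq_bigr => i _; last by rewrite lift_perm_lift.
rewrite big_mkcond big_ord_recl /= mul1r [RHS]big_mkcond /=.
by apply: eq_bigr => j _; rewrite !lift_perm_lift.
Qed.

Hypothesis d_total : forall S : {set T},
  \sum_(s in S) \prod_(t in S :\ s) d s t = #|S|%:R.

Definition cross (I J : {set T}) : F := \prod_(i in I) \prod_(j in J) d i j.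

(** Collect the orderings according to the set I of their first l elements.  In
the induction, the element s moved into I contributes prod_(t in I, t != s) d(s,t),
and [d_total] turns the sum of these over s in I into #|I|, whence the
factorial. *)
Lemma ordering_sum_nseq (l : nat) (a : T -> F) (phis : seq (T -> F))
    (S : {set T}) : (l <= #|S|)%N ->
  ordering_sum (nseq l a ++ phis) S
  = l`!%:R * \sum_(I : {set T} | (I \subset S) && (#|I| == l))
      (\prod_(i in I) a i) * cross I (S :\: I) * ordering_sum phis (S :\: I).
Proof.
elim: l S => [|l IH] S le_lS /=.
  rewrite (big_pred1 set0) => [|I]; last first.
    by rewrite cards_eq0 andbC /=; case: eqP => // ->; rewrite sub0set.
  by rewrite /cross !big_set0 !mul1r setD0.
pose term (I : {set T}) := (\prod_(i in I) a i) * cross I (S :\: I)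
               * ordering_sum phis (S :\: I).
have step s (I : {set T}) : s \in I -> I \subset S ->
  a s * (\prod_(t in S :\ s) d s t)
    * ((\prod_(i in I :\ s) a i) * cross (I :\ s) (S :\ s :\: (I :\ s))
       * ordering_sum phis (S :\ s :\: (I :\ s)))
  = (\prod_(t in I :\ s) d s t) * term I.
  move=> Is IS.
  have -> : S :\ s :\: (I :\ s) = S :\: I.
    apply/setP => t; rewrite !inE; case: (eqVneq t s) => [-> |] //=.
    by rewrite Is.
  have -> : \prod_(t in S :\ s) d s t
            = (\prod_(t in I :\ s) d s t) * \prod_(t in S :\: I) d s t.
    rewrite (big_setID (I :\ s)) /=; congr (_ * _); apply: eq_bigl => t.
      rewrite !inE; case: (eqVneq t s) => //= _.
      by rewrite andbC; case: (boolP (t \in I)) => // /(subsetP IS) ->.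
    by rewrite !inE; case: (eqVneq t s) => [-> |] //=; rewrite Is.
  rewrite /term /cross (big_setD1 s Is) [in RHS](big_setD1 s Is) /=.
  ring.
have le_l s : s \in S -> (l <= #|S :\ s|)%N.
  by move=> Ss; rewrite (cardsD1 s S) Ss in le_lS.
under eq_bigr => s Ss do rewrite (IH _ (le_l s Ss)) mulrCA mulr_sumr.
rewrite -mulr_sumr factS mulnC natrM -mulrA; congr (_ * _).
transitivity (\sum_(s in S) \sum_(I : {set T} |
    [&& s \in I, I \subset S & #|I| == l.+1]) (\prod_(t in I :\ s) d s t) * term I).
  apply: eq_bigr => s Ss.
  rewrite [RHS](reindex_onto (fun I => s |: I) (fun I => I :\ s)) /=; last first.
    by move=> I /and3P[Is _ _]; rewrite setD1K.
  apply: eq_big => [I | I].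
    rewrite setU11 subUset sub1set Ss /=.
    rewrite subsetD1 -andbA; case: (boolP (I \subset S)) => //= IS.
    case: (boolP (s \in I)) => [Is | nIs] /=.
      by rewrite [X in _ && X]negbTE ?andbF //; apply/eqP => /setP/(_ s);
         rewrite !inE eqxx Is.
    by rewrite cardsU1 nIs add1n eqSS setU1K // eqxx andbT.
  rewrite subsetD1 => /andP[/andP[IS nIs] _].
  by rewrite -step ?setU11 ?subUset ?sub1set ?Ss ?IS // setU1K.
rewrite (exchange_big_dep (fun I : {set T} => (I \subset S) && (#|I| == l.+1))) /=;
  last by move=> s I _ /and3P[_ -> ->].
rewrite mulr_sumr; apply: eq_bigr => I /andP[IS /eqP cardI].
rewrite -mulr_suml -cardI -d_total; congr (_ * _).
apply: eq_bigl => s; rewrite IS cardI eqxx !andbT.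
by case: (boolP (s \in I)) => [/(subsetP IS) -> | _]; rewrite ?andbF.
Qed.

Lemma ordering_sum_const (k : nat) (b : T -> F) (S : {set T}) : #|S| = k ->
  ordering_sum (nseq k b) S = k`!%:R * \prod_(s in S) b s.
Proof.
move=> cardS; rewrite -[nseq k b]cats0 ordering_sum_nseq ?cardS //.
congr (_ * _); rewrite (big_pred1 S) => [|I]; last first.
  rewrite -cardS /= eqEcard eqn_leq.
  by case: (boolP (I \subset S)) => //= /subset_leq_card ->.
rewrite setDv /cross [X in _ * X * _]big1 ?mulr1 // => i _.
by rewrite big_set0.
Qed.

Lemma ordering_sum_marked (l k : nat) (a f b : T -> F) (S : {set T}) :
    #|S| = (l + k).+1 ->
  ordering_sum (nseq l a ++ f :: nseq k b) S
  = (l`! * k`!)%:R * \sum_(m in S) f m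
      * \sum_(I : {set T} | (I \subset S :\ m) && (#|I| == l))
          (\prod_(i in I) a i) * cross I (S :\: I)
          * \prod_(t in S :\: I :\ m) (d m t * b t).
Proof.
move=> cardS; rewrite ordering_sum_nseq ?cardS ?leqW ?leq_addr //.
rewrite natrM -mulrA; congr (_ * _).
transitivity (\sum_(I : {set T} | (I \subset S) && (#|I| == l))
  \sum_(m in S :\: I) k`!%:R * (f m * ((\prod_(i in I) a i) * cross I (S :\: I)
     * \prod_(t in S :\: I :\ m) (d m t * b t)))).
  apply: eq_bigr => I /andP[IS /eqP cardI].
  rewrite /= mulr_sumr; apply: eq_bigr => m mSI.
  have cardSIm : #|S :\: I :\ m| = k.
    have := cardsD1 m (S :\: I).
    rewrite mSI cardsD (setIidPr IS) cardI cardS.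
    by rewrite -addnS addKn => -[->].
  rewrite (ordering_sum_const _ cardSIm) big_split /=.
  ring.
rewrite (exchange_big_dep (mem S)) /= => [|I m _]; last first.
  by rewrite inE => /andP[].
rewrite mulr_sumr; apply: eq_bigr => m Sm; rewrite -!mulr_sumr.
congr (_ * (_ * _)); apply: eq_bigl => I.
by rewrite inE Sm andbT subsetD1 andbAC.
Qed.

End Orderings.

(** * The cyclic shift and the left-hand side *)

Section CyclicShift.

Variables (F : fieldType) (c : F).

(** The substitution of variables by which theta acts: [theta c g u] is
convertible to [g (cyclic_shift u)]. *)
Definition cyclic_shift (n : nat) (u : {ffun 'I_n -> F}) : {ffun 'I_n -> F} :=
  [ffun i : 'I_n => if i.+1 == n then u (ordS i) + c else u (ordS i)].

Lemma cyclic_shiftE (n : nat) (u : {ffun 'I_n -> F}) (i : 'I_n) :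
  cyclic_shift u i = u (ordS i) + (if i.+1 == n then c else 0).
Proof. by rewrite ffunE; case: eqP; rewrite ?addr0. Qed.

Lemma iter_one_sub_theta (n k : nat) (g : {ffun 'I_n -> F} -> F) u :
  iter k (one_sub_theta c) g u
  = \sum_(l < k.+1) (-1) ^+ l * 'C(k, l)%:R * g (iter l (@cyclic_shift n) u).
Proof.
elim: k u => [|k IH] u; first by rewrite big_ord1 bin0 !mul1r.
rewrite /= /one_sub_theta /theta -/(cyclic_shift u) !{}IH.
rewrite [RHS]big_ord_recl [X in X - _]big_ord_recl /= !bin0 -addrA; congr (_ + _).
under [RHS]eq_bigr => l _.
  rewrite /bump /= add1n binS natrD mulrDr mulrDl.
  over.
rewrite /= big_split /= [X in _ = X + _]big_ord_recr /= bin_small // mulr0 mul0r addr0.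
congr (_ + _); rewrite -sumrN; apply: eq_bigr => l _.
by rewrite exprS mulN1r !mulNr -iterSr.
Qed.

Lemma val_iter_ordS (n l : nat) (i : 'I_n) :
  val (iter l (@ordS n) i) = ((i + l) %% n)%N.
Proof.
elim: l => [|l IH] /=; first by rewrite addn0 modn_small.
by rewrite IH -addn1 modnDml addn1 addnS.
Qed.

Lemma iter_cyclic_shift (n l : nat) (u : {ffun 'I_n -> F}) (i : 'I_n) :
  (l <= n)%N ->
  iter l (@cyclic_shift n) u i
  = u (iter l (@ordS n) i) + (if (n <= i + l)%N then c else 0).
Proof.
elim: l i => [|l IH] i lt_ln /=.
  by rewrite addn0 leqNgt ltn_ord addr0.
have -> : ordS (iter l (@ordS n) i) = iter l (@ordS n) (ordS i).
  by rewrite -iterSr.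
rewrite cyclic_shiftE.
rewrite !(IH _ (ltnW lt_ln)).
rewrite -addrA addnS -addSn [nat_of_ord (ordS i)]/=; congr (_ + _).
case: eqP => [iE | /eqP iN].
  by rewrite iE modnn add0n leqNgt lt_ln add0r leq_addr.
by rewrite addr0 modn_small // ltn_neqAle iN ltn_ord.
Qed.

(** After l shifts the position j carries the variable of index j + l modulo n,
increased by c when the index has wrapped around.  Indexed by variables instead
of positions, the shifted product is thus the list of weights: l times P(. + c),
then f, then P. *)
Lemma iter_cyclic_shift_prod (p l : nat) (P f : F -> F)
    (u : {ffun 'I_p.+1 -> F}) (w : 'S_p.+1) : (l <= p)%N ->
  let y := iter l (@cyclic_shift p.+1) [ffun i => u (w i)] in
  (\prod_(j < p.+1 | (0 < j)%N) P (y j)) * f (y ord0)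
  = \prod_(i < p.+1) nth (fun=> 1)
      (nseq l (fun t => P (u t + c)) ++ (fun t => f (u t))
         :: nseq (p - l) (fun t => P (u t))) i (w i).
Proof.
move=> le_lp y; have lt_lp : (l < p.+1)%N by [].
have iter_ordS_inj : injective (iter l (@ordS p.+1)).
  by elim: l {y le_lp lt_lp} => //= l IHl; apply: inj_comp IHl; exact: ordS_inj.
rewrite [RHS](reindex_inj iter_ordS_inj) /=.
rewrite [RHS](bigD1 ord0) //= mulrC /y.
rewrite iter_cyclic_shift ?(ltnW lt_lp) // add0n leqNgt lt_lp addr0 ffunE.
rewrite val_iter_ordS add0n modn_small // nth_cat size_nseq ltnn subnn /=.
congr (_ * _); apply: eq_big => [j | j j_gt0]; first by rewrite lt0n.
rewrite iter_cyclic_shift ?(ltnW lt_lp) // ffunE val_iter_ordS.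
rewrite nth_cat size_nseq; case: (ltnP p (j + l)) => [ge_jl | lt_jl].
  have lt_jlp : (j + l - p.+1 < l)%N.
    by rewrite -(ltn_add2r p.+1) subnK // [X in (_ < X)%N]addnC ltn_add2r.
  rewrite -(subnK ge_jl) modnDr modn_small ?lt_jlp ?nth_nseq ?lt_jlp //.
  exact: ltn_trans lt_lp.
rewrite modn_small // ltnNge leq_addl /= addnK addr0 -[X in nth _ _ X](prednK j_gt0).
by rewrite /= nth_nseq prednK // leq_subRL // [(l + j)%N]addnC lt_jl.
Qed.

End CyclicShift.

Definition shifted_ratio (F : fieldType) (T : finType) (c : F) (u : T -> F)
  (s t : T) : F := (u s - u t - c) / (u s - u t).

(** The coefficient B_m.  The index m counts as an element outside I, so that
[cross] contains the factors d(i,m) for i in I. *)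
Definition marked_subset_sum (F : fieldType) (T : finType) (c : F) (u : T -> F)
    (P : F -> F) (m : T) : F :=
  \sum_(I : {set T} | m \notin I)
    (-1) ^+ #|I| * (\prod_(i in I) P (u i + c))
    * cross (shifted_ratio c u) I (~: I)
    * \prod_(t in ~: I :\ m) (shifted_ratio c u m t * P (u t)).

(** By [ordering_sum_marked], the l-th term of the binomial expansion carries
l! (n-1-l)!, so that its total numerical factor is (-1)^l (n-1)!; the sum over l
then merges the sums over subsets of size l into one. *)
Lemma Sym_iter_one_sub_theta (F : fieldType) (p : nat) (c : F)
    (u : {ffun 'I_p.+1 -> F}) (P f : F -> F) : injective u ->
  Sym c (iter p (one_sub_theta c)
    (fun x => (\prod_(j < p.+1 | (0 < j)%N) P (x j)) * f (x ord0))) u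
  = p`!%:R * \sum_m f (u m) * marked_subset_sum c u P m.
Proof.
move=> u_inj; pose d := shifted_ratio c u.
pose phis l := nseq l (fun t => P (u t + c)) ++ (fun t => f (u t))
                 :: nseq (p - l) (fun t => P (u t)).
have d_total (S : {set 'I_p.+1}) :
    \sum_(s in S) \prod_(t in S :\ s) d s t = #|S|%:R.
  by apply: sum_prod_shifted_ratio => s t _ _; apply: u_inj.
transitivity (\sum_(l < p.+1) (-1) ^+ l * 'C(p, l)%:R * ordering_sum d (phis l) setT).
  rewrite /Sym /permute_vars.
  transitivity (\sum_(w : 'S_p.+1) \sum_(l < p.+1) (-1) ^+ l * 'C(p, l)%:R *
     ((\prod_(i < p.+1) \prod_(j < p.+1 | (i < j)%N) d (w i) (w j))
       * \prod_(i < p.+1) nth (fun=> 1) (phis l) i (w i))).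
    apply: eq_bigr => w _; rewrite iter_one_sub_theta mulr_sumr.
    apply: eq_bigr => l _; rewrite -iter_cyclic_shift_prod ?leq_ord //.
    rewrite mulrCA; congr (_ * (_ * _)).
    apply: eq_bigr => i _; apply: eq_bigr => j _.
    by rewrite !ffunE.
  rewrite exchange_big /=; apply: eq_bigr => l _; rewrite -mulr_sumr; congr (_ * _).
  rewrite (sum_perm_ordering d (g := id)) //.
    by congr ordering_sum; apply/setP => i; rewrite inE; apply/imsetP; exists i.
  by rewrite size_cat /= !size_nseq addnS subnKC // leq_ord.
under eq_bigr => l _.
  rewrite (ordering_sum_marked d_total); last first.
    by rewrite cardsT card_ord subnKC // leq_ord.
  rewrite -mulrA [X in _ * X]mulrA -natrM bin_fact ?leq_ord // mulrCA.
  over.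
rewrite /= -mulr_sumr; congr (_ * _).
under [LHS]eq_bigr do rewrite mulr_sumr.
rewrite exchange_big /=.
apply: eq_big => [m|m _]; first by rewrite inE.
under [LHS]eq_bigr do rewrite mulrCA.
rewrite -mulr_sumr; congr (_ * _).
rewrite /marked_subset_sum.
have card_lt (I : {set 'I_p.+1}) : m \notin I -> (#|I| < p.+1)%N.
  move=> mI; rewrite ltnNge; apply: contra mI => le_pI.
  have /eqP -> : I == setT by rewrite eqEcard subsetT cardsT card_ord.
  by rewrite inE.
rewrite (partition_big (fun I : {set _} => inord #|I| : 'I_p.+1) predT) //=.
apply: eq_bigr => l _; rewrite mulr_sumr; apply: eq_big => [I | I].
  rewrite subsetD1 subsetT /=; case: (boolP (m \in I)) => //= mI.
  by rewrite -val_eqE /= inordK // card_lt.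
by rewrite !setTD => /andP[_ /eqP <-]; rewrite !mulrA.
Qed.

(** * Determinants with two evaluation points per row *)

Section Determinants.

Variables (F : fieldType) (n : nat).

Lemma det_addmx (A B : 'M[F]_n) :
  \det (A + B)
  = \sum_(I : {set 'I_n}) \det (\matrix_(i, j) (if i \in I then A i j else B i j)).
Proof.
rewrite /determinant; under eq_bigr => s _.
  under eq_bigr do rewrite mxE.
  rewrite bigA_distr mulr_sumr.
  over.
rewrite exchange_big /=; apply: eq_bigr => I _; apply: eq_bigr => s _.
by congr (_ * _); apply: eq_bigr => i _; rewrite mxE.
Qed.

Lemma det_scaled_powers (s x : 'I_n -> F) :
  \det (\matrix_(k, a) (s k * x k ^+ a) : 'M[F]_n)
  = (\prod_k s k) * \prod_(i < n) \prod_(j < n | (i < j)%N) (x j - x i).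
Proof.
have -> : \matrix_(k, a) (s k * x k ^+ a)
   = diag_mx (\row_k s k) *m (Vandermonde n (\row_k x k))^T :> 'M[F]_n.
  by apply/matrixP => k a; rewrite mul_diag_mx !mxE.
rewrite det_mulmx det_diag det_tr det_Vandermonde.
congr (_ * _); first by apply: eq_bigr => k _; rewrite mxE.
by apply: eq_bigr => i _; apply: eq_bigr => j _; rewrite !mxE.
Qed.

Lemma prod_ordered_pairs (G : 'I_n -> 'I_n -> F) : (forall i, G i i = 1) ->
  \prod_i \prod_j G i j = \prod_(i < n) \prod_(j < n | (i < j)%N) (G i j * G j i).
Proof.
move=> G_diag.
have -> : \prod_i \prod_j G i j
    = \prod_(i < n) ((\prod_(j < n | (i < j)%N) G i j) * \prod_(j < n | (j < i)%N) G i j).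
  apply: eq_bigr => i _; rewrite (bigD1 i) //= G_diag mul1r.
  rewrite (bigID (fun j : 'I_n => i < j)%N) /=.
  congr (_ * _); apply: eq_bigl => j; rewrite -val_eqE /=.
    by case: ltngtP.
  by case: ltngtP.
rewrite big_split /= [X in _ * X](exchange_big_dep predT) //= -big_split /=.
by apply: eq_bigr => i _; rewrite -big_split.
Qed.

(** Only the pairs separated by I change: for i in I and j outside,
(u_j + c - u_i) / (u_j - u_i) = d(i,j). *)
Lemma vandermonde_partial_shift (c : F) (u : 'I_n -> F) (I : {set 'I_n}) :
    injective u -> let x k := if k \in I then u k else u k + c in
  \prod_(i < n) \prod_(j < n | (i < j)%N) (x j - x i)
  = \prod_(i < n) \prod_(j < n | (i < j)%N) (u j - u i)
    * cross (shifted_ratio c u) I (~: I).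
Proof.
move=> u_inj x.
pose G i j := if (i \in I) && (j \notin I) then shifted_ratio c u i j else 1.
have -> : cross (shifted_ratio c u) I (~: I) = \prod_i \prod_j G i j.
  rewrite /cross big_mkcond /=; apply: eq_bigr => i _; rewrite /G.
  case: (i \in I); last by rewrite big1.
  by rewrite big_mkcond; apply: eq_bigr => j _; rewrite inE.
rewrite prod_ordered_pairs => [|i]; last by rewrite /G andbN.
rewrite -big_split; apply: eq_bigr => i _ /=.
rewrite -big_split; apply: eq_bigr => j lt_ij /=.
have uij : u i - u j != 0.
  by rewrite subr_eq0 (inj_eq u_inj) -val_eqE /= neq_ltn lt_ij.
have uji : u j - u i != 0 by rewrite -opprB oppr_eq0.
rewrite /G /x /shifted_ratio.
by case: (i \in I); case: (j \in I) => /=; field.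
Qed.

End Determinants.

(** * Evaluation of the marked subset sum *)
Section MarkedSum.

Variables (F : fieldType) (n : nat) (c : F) (u : 'I_n -> F).
Hypothesis u_inj : injective u.

Definition marked_mx (P : F -> F) (m : 'I_n) : 'M[F]_n :=
  \matrix_(k, a) if k == m then (u m + c) ^+ a
                 else (u k + c - u m) * (u k + c) ^+ a * P (u k)
                      - (u k - u m) * u k ^+ a * P (u k + c).

(** Each row is a combination of evaluations at u_k and at u_k + c.  Expanding
the determinant by the set I of rows that use u_k gives scaled Vandermonde
determinants; row m uses only u_m + c, hence only the sets I avoiding m
contribute. *)
Lemma det_marked_mx (P : F -> F) (m : 'I_n) :
  \det (marked_mx P m)
  = \prod_(i < n) \prod_(j < n | (i < j)%N) (u j - u i)
    * \prod_(k | k != m) (u k - u m) * marked_subset_sum c u P m.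
Proof.
pose al k := if k == m then 0 else - (u k - u m) * P (u k + c).
pose be k := if k == m then 1 else (u k + c - u m) * P (u k).
have -> : marked_mx P m = \matrix_(k, a) (al k * u k ^+ a)
                          + \matrix_(k, a) (be k * (u k + c) ^+ a).
  apply/matrixP => k a; rewrite !mxE /al /be.
  by case: eqVneq => [-> | _]; ring.
rewrite det_addmx /marked_subset_sum mulr_sumr [RHS]big_mkcond /=.
apply: eq_bigr => I _.
pose x k := if k \in I then u k else u k + c.
have -> : (\matrix_(i, j) (if i \in I
              then (\matrix_(k, a) (al k * u k ^+ a)) i j
              else (\matrix_(k, a) (be k * (u k + c) ^+ a)) i j))
    = \matrix_(k, a) ((if k \in I then al k else be k) * x k ^+ a) :> 'M[F]_n.
  by apply/matrixP => k a; rewrite !mxE /x; case: ifP.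
rewrite det_scaled_powers vandermonde_partial_shift //.
case: (boolP (m \in I)) => [mI | mI] /=.
  by rewrite (bigD1 m) //= mI /al eqxx !mul0r.
set V := \prod_(i < n) \prod_(j < n | _) _; set C := cross _ _ _.
suff -> : \prod_k (if k \in I then al k else be k)
    = \prod_(k | k != m) (u k - u m)
      * ((-1) ^+ #|I| * (\prod_(i in I) P (u i + c))
         * \prod_(t in ~: I :\ m) (shifted_ratio c u m t * P (u t))) by ring.
rewrite (bigID (mem I)) [X in _ = X * _](bigID (mem I)) /=.
have -> : \prod_(i in I) (if i \in I then al i else be i)
    = (-1) ^+ #|I| * \prod_(i in I) (u i - u m) * \prod_(i in I) P (u i + c).
  rewrite -prodrN -big_split; apply: eq_bigr => i Ii /=.
  by rewrite Ii /al; case: eqP => // im; rewrite -im Ii in mI.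
have -> : \prod_(i | (i != m) && (i \in I)) (u i - u m) = \prod_(i in I) (u i - u m).
  by apply: eq_bigl => i; case: eqP => [-> |] //=; rewrite (negbTE mI).
have -> : \prod_(i | i \notin I) (if i \in I then al i else be i)
   = \prod_(i | (i != m) && (i \notin I)) (u i - u m)
     * \prod_(t in ~: I :\ m) (shifted_ratio c u m t * P (u t)).
  rewrite (bigD1 m) //= (negbTE mI) {1}/be eqxx mul1r.
  have E t : (t \in ~: I :\ m) = (t != m) && (t \notin I) by rewrite !inE.
  rewrite [X in _ = _ * X](eq_bigl _ _ E) -big_split /=.
  apply: eq_big => [t | t /andP[tI tm]]; first by rewrite andbC.
  rewrite (negbTE tI) /be (negbTE tm) /shifted_ratio.
  have utm : u m - u t != 0 by rewrite subr_eq0 (inj_eq u_inj) eq_sym.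
  by field.
by ring.
Qed.

Variable v : 'I_n -> F.
Hypothesis v_inj : injective v.
Hypothesis v_neq_u : forall j k, v j - u k != 0.
Hypothesis v_neq_uc : forall j k, v j - u k - c != 0.

Let P (x : F) := \prod_(j < n) (x - v j).
Let dP (j : 'I_n) := \prod_(t | t != j) (v j - v t).

(** The expression q(x) P(y) - q(y) P(x) is zero at q = P, so q may be replaced by
q minus a multiple of P, of degree less than n, which its values at the v_j
determine. *)
Lemma bezout_interpolation (q : {poly F}) (x y : F) : (size q <= n.+1)%N ->
    (forall j, x - v j != 0) -> (forall j, y - v j != 0) ->
  q.[x] * P y - q.[y] * P x
  = P x * P y * \sum_j ((x - v j)^-1 - (y - v j)^-1) * (q.[v j] / dP j).
Proof.
move=> sz_q x_neq y_neq.
pose pP := \prod_(j < n) ('X - (v j)%:P).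
have pPE z : pP.[z] = P z.
  by rewrite horner_prod; apply: eq_bigr => j _; rewrite hornerXsubC.
have sz_pP : size pP = n.+1.
  by rewrite /pP -big_enum size_prod_XsubC size_enum_ord.
pose r := q - q`_n *: pP.
have sz_r : (size r <= #|[set: 'I_n]|)%N.
  rewrite cardsT card_ord; apply/leq_sizeP => j.
  rewrite leq_eqVlt => /predU1P[<- | lt_nj].
    have lead : pP`_n = 1.
      have /monicP : pP \is monic by apply: monic_prod_XsubC.
      by rewrite lead_coefE sz_pP.
    by rewrite coefB coefZ lead mulr1 subrr.
  rewrite coefB coefZ [q`_j]nth_default ?[pP`_j]nth_default ?sz_pP //.
    by rewrite mulr0 subr0.
  exact: leq_trans sz_q lt_nj.
have r_v j : r.[v j] = q.[v j].
  by rewrite hornerD hornerN hornerZ pPE /P (bigD1 j) //= subrr mul0r mulr0 subr0.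
have v_inj' : {in [set: 'I_n] &, injective v} by move=> i j _ _; apply: v_inj.
have r_val z : (forall j, z - v j != 0) ->
    r.[z] = P z * \sum_j (z - v j)^-1 * (q.[v j] / dP j).
  move=> z_neq; rewrite [in LHS](lagrange_interpolation v_inj' sz_r).
  rewrite horner_sum mulr_sumr; apply: eq_big => [j | j _]; first by rewrite inE.
  have E t : (t \in [set: 'I_n] :\ j) = (t != j) by rewrite !inE andbT.
  have -> : P z = (z - v j) * \prod_(t | t != j) (z - v t) by rewrite /P (bigD1 j).
  rewrite hornerZ horner_prod r_v !(eq_bigl _ _ E) -/(dP j).
  rewrite (eq_bigr _ (fun t _ => hornerXsubC (v t) z)).
  by rewrite [RHS]mulrACA mulfV // mul1r mulrC.
transitivity (r.[x] * P y - r.[y] * P x).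
  by rewrite !hornerD !hornerN !hornerZ !pPE; ring.
rewrite !r_val //.
under [in RHS]eq_bigr do rewrite mulrBl.
by rewrite sumrB; ring.
Qed.

Let K := \matrix_(j < n, k < n) (1 / ((v j - u k) * (v j - u k - c))).

(** With q_a = (x - u_m) x^a, the functional L_m gives
L_m(q_a) = c P(u_m) (u_m + c)^a, so scaling row m of [marked_mx] by c P(u_m)
produces the matrix (L_k(q_a)).  It factors through the values q_a(v_j) by
[bezout_interpolation], where
1/(u_k + c - v_j) - 1/(u_k - v_j) = -c / ((v_j - u_k)(v_j - u_k - c)). *)
Lemma det_marked_mx_cauchy (m : 'I_n) :
  c * P (u m) * \det (marked_mx P m)
  = (- c) ^+ n * \prod_k (P (u k) * P (u k + c)) * \det K
    * (\prod_j (v j - u m) / \prod_j dP j)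
    * \prod_(i < n) \prod_(j < n | (i < j)%N) (v j - v i).
Proof.
pose N := diag_mx (\row_k if k == m then c * P (u m) else 1) *m marked_mx P m.
have -> : c * P (u m) * \det (marked_mx P m) = \det N.
  rewrite det_mulmx det_diag; congr (_ * _).
  rewrite (bigD1 m) //= mxE eqxx big1 ?mulr1 // => k km.
  by rewrite mxE (negbTE km).
have -> : N = diag_mx (\row_k (- c * (P (u k) * P (u k + c)))) *m K^T
    *m (\matrix_(j, a) ((v j - u m) / dP j * v j ^+ a)).
  apply/matrixP => k a.
  have u_neq_v j : u k - v j != 0 by rewrite -opprB oppr_eq0.
  have uc_neq_v j : u k + c - v j != 0 by rewrite -opprB oppr_eq0 opprD addrA.
  pose q : {poly F} := ('X - (u m)%:P) * 'X^a.
  have sz_q : (size q <= n.+1)%N.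
    by rewrite size_monicM ?monicXsubC ?monic_neq0 ?monicXn // size_XsubC size_polyXn ltnS.
  have qE z : q.[z] = (z - u m) * z ^+ a by rewrite hornerM hornerXsubC hornerXn.
  transitivity (q.[u k + c] * P (u k) - q.[u k] * P (u k + c)).
    rewrite /N mul_diag_mx !mxE !qE; case: eqVneq => [-> | _]; ring.
  rewrite bezout_interpolation // [RHS]mxE mulr_sumr; apply: eq_bigr => j _.
  rewrite mul_diag_mx !mxE qE.
  have := v_neq_u j k; have := v_neq_uc j k.
  have := u_neq_v j; have := uc_neq_v j.
  have : dP j != 0.
    apply/prodf_neq0 => t tj; rewrite subr_eq0 (inj_eq v_inj) eq_sym //.
  move: (dP j) => D; move: (P _) => Pu; move: (P _) => Puc.
  by move=> *; field; apply/and5P; split.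
rewrite !det_mulmx det_diag det_tr det_scaled_powers.
under eq_bigr do rewrite mxE.
by rewrite big_split /= prodr_const card_ord prodf_div; ring.
Qed.

Lemma marked_subset_sum_det (m : 'I_n) : (1 < n)%N ->
  marked_subset_sum c u P m
  = (- c) ^+ n.-1
    * ((\prod_(i < n) \prod_(k < n) ((v i - u k) * (v i - u k - c)))
       / ((\prod_(i < n) \prod_(j < n | (i < j)%N) (v j - v i))
          * (\prod_(i < n) \prod_(j < n | (i < j)%N) (u i - u j))))
    * \det K / \prod_(k | k != m) (u m - u k).
Proof.
move=> n_gt1; have det_eq := det_marked_mx P m.
have u_neq i j : i != j -> u i - u j != 0 by rewrite subr_eq0 (inj_eq u_inj).
have neq_lt (i j : 'I_n) : (i < j)%N -> j != i by move=> lt_ij; rewrite -val_eqE gtn_eqF.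
pose Vu := \prod_(i < n) \prod_(j < n | (i < j)%N) (u j - u i).
pose Vv := \prod_(i < n) \prod_(j < n | (i < j)%N) (v j - v i).
pose Vv' := \prod_(i < n) \prod_(j < n | (i < j)%N) (v i - v j).
have Vu_neq0 : Vu != 0.
  by apply/prodf_neq0 => i _; apply/prodf_neq0 => j /neq_lt /u_neq.
have Vv_neq0 : Vv != 0.
  apply/prodf_neq0 => i _; apply/prodf_neq0 => j /neq_lt ij.
  by rewrite subr_eq0 (inj_eq v_inj).
have Vv'_neq0 : Vv' != 0.
  apply/prodf_neq0 => i _; apply/prodf_neq0 => j /neq_lt ij.
  by rewrite subr_eq0 (inj_eq v_inj) eq_sym.
pose Q := \prod_(k | k != m) (u m - u k).
have Q_neq0 : Q != 0 by apply/prodf_neq0 => k km; apply: u_neq; rewrite eq_sym.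
have Q_opp : \prod_(k | k != m) (u k - u m) = (-1) ^+ n.-1 * Q.
  rewrite -[n in n.-1]card_ord -(cardC1 m) -prodrN.
  by apply: eq_bigr => k _; rewrite opprB.
rewrite -/Vu -/Q Q_opp in det_eq *.
have [c0 | c_neq0] := eqVneq c 0.
  (* det_marked_mx_cauchy is void at c = 0; there every row k != m of the
     marked matrix is zero, and one exists because n > 1. *)
  rewrite [in RHS]c0 oppr0 expr0n -subn1 subn_eq0 leqNgt n_gt1 !mul0r.
  have [k km] : exists k, k != m.
    have [<- | m_neq1] := eqVneq (Ordinal n_gt1) m; last by exists (Ordinal n_gt1).
    by exists (Ordinal (ltnW n_gt1)); rewrite -val_eqE.
  have det0 : \det (marked_mx P m) = 0.
    rewrite (expand_det_row _ k) big1 // => a _.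
    by rewrite mxE (negbTE km) c0 !addr0 subrr mul0r.
  apply/eqP; move/eqP: det_eq; rewrite det0 eq_sym !mulf_eq0 (negbTE Vu_neq0).
  by rewrite (negbTE Q_neq0) expf_eq0 oppr_eq0 oner_eq0 andbF.
have V_opp : Vv * (\prod_(i < n) \prod_(j < n | (i < j)%N) (u i - u j)) = Vv' * Vu.
  rewrite -!big_split; apply: eq_bigr => i _; rewrite -!big_split /=.
  by apply: eq_bigr => j _; rewrite -mulrNN !opprB.
rewrite -/Vv V_opp.
pose W := \prod_j (v j - u m).
have W_neq0 : W != 0 by apply/prodf_neq0.
have P_um : P (u m) = (-1) ^+ n * W.
  rewrite -[in X in _ ^+ X](card_ord n) -prodrN.
  by apply: eq_bigr => j _; rewrite opprB.
have dP_Vv : \prod_j dP j = Vv * Vv'.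
  pose G i j := if i == j then 1 else v i - v j.
  transitivity (\prod_i \prod_j G i j).
    apply: eq_bigr => i _; rewrite /dP [RHS](bigD1 i) //= /G eqxx mul1r.
    by apply: eq_bigr => j; rewrite eq_sym => /negbTE ->.
  rewrite prod_ordered_pairs => [|i]; last by rewrite /G eqxx.
  rewrite -big_split; apply: eq_bigr => i _; rewrite -big_split /=.
  apply: eq_bigr => j /neq_lt ji; rewrite /G (negbTE ji) eq_sym (negbTE ji).
  by rewrite mulrC.
have PP : \prod_k (P (u k) * P (u k + c))
    = \prod_(i < n) \prod_(k < n) ((v i - u k) * (v i - u k - c)).
  rewrite exchange_big /=; apply: eq_bigr => k _; rewrite -big_split.
  by apply: eq_bigr => i _ /=; rewrite -mulrNN !opprB opprD addrA.
have := det_marked_mx_cauchy m.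
rewrite det_eq PP -/Vv -/W dP_Vv P_um.
have exprn (x : F) : x ^+ n = x * x ^+ n.-1 by rewrite -exprS prednK // ltnW.
have := sqrr_sign F n.-1; rewrite !exprn expr2.
move: (marked_subset_sum _ _ _ _) (\det K) ((-1) ^+ _) ((- c) ^+ _) => B dK s cn ss.
set X := \prod_(i < n) \prod_(k < n) _ => eq_B.
have x_neq0 : c * W * Vu * Q != 0 by rewrite !mulf_neq0.
apply: (mulfI x_neq0).
have -> : c * W * Vu * Q * B = - (c * (-1 * s * W) * (Vu * (s * Q) * B)).
  rewrite [RHS](_ : _ = s * s * (c * W * Vu * Q * B)); last by ring.
  by rewrite ss mul1r.
by rewrite eq_B; field; apply/and4P; split.
Qed.

End MarkedSum.

(** * Newton's form of the iterated divided difference *)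

Section DividedDifferences.

Variables (F : fieldType) (n : nat) (f : F -> F).

(** The divided difference of f at the nodes x_0, ..., x_k. *)
Definition newton_form (k : nat) (x : {ffun 'I_n -> F}) : F :=
  \sum_(m < n | (m <= k)%N)
     f (x m) / \prod_(j < n | (j <= k)%N) (if j == m then 1 else x m - x j).

(** The terms m < k combine by
1/(x_m - x_k) - 1/(x_m - x_(k+1)) = (x_k - x_(k+1)) / ((x_m - x_k)(x_m - x_(k+1))),
and the term m = k, together with its image under the swap, gives the terms k
and k + 1. *)
Lemma divdiff_newton_form (k : 'I_n) (x : {ffun 'I_n -> F}) :
  (k.+1 < n)%N -> injective x ->
  divdiff k (newton_form k) x = newton_form k.+1 x.
Proof.
move=> lt_k1n x_inj; rewrite /divdiff /permute_vars; set k1 := ordS k.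
have k1E : nat_of_ord k1 = k.+1 by rewrite /= modn_small.
have x_neq i j : i != j -> x i - x j != 0 by rewrite subr_eq0 (inj_eq x_inj).
have k_neq : k != k1 by rewrite -val_eqE [val k1]k1E /= neq_ltn ltnSn.
have lt_neq (m i : 'I_n) : (m < i)%N -> (m == i) = false.
  by move=> lt_mi; rewrite -val_eqE ltn_eqF.
have leE (m i : 'I_n) : (m <= i)%N && (m != i) = (m < i)%N.
  by rewrite ltn_neqAle andbC.
pose D (y : {ffun 'I_n -> F}) m j := if j == m then 1 else y m - y j.
pose low y m := \prod_(j < n | (j < k)%N) D y m j.
have den_k y m : \prod_(j < n | (j <= k)%N) D y m j = D y m k * low y m.
  by rewrite (bigD1 k) //=; congr (_ * _); apply: eq_bigl => j; rewrite leE.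
have den_k1 y m : \prod_(j < n | (j <= k.+1)%N) D y m j
    = D y m k1 * (D y m k * low y m).
  rewrite (bigD1 k1) ?k1E //= -den_k; congr (_ * _); apply: eq_bigl => j.
  by rewrite -k1E leE k1E.
have newton_k y : newton_form k y
   = f (y k) / low y k + \sum_(m < n | (m < k)%N) f (y m) / ((y m - y k) * low y m).
  rewrite /newton_form (bigD1 k) //= den_k {1}/D eqxx mul1r; congr (_ + _).
  apply: eq_big => m; first by rewrite leE.
  by rewrite leE => lt_mk; rewrite den_k {1}/D eq_sym lt_neq.
have newton_k1 : newton_form k.+1 x
   = f (x k1) / ((x k1 - x k) * low x k1) + (f (x k) / ((x k - x k1) * low x k)
     + \sum_(m < n | (m < k)%N) f (x m) / ((x m - x k1) * ((x m - x k) * low x m))).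
  rewrite /newton_form (bigD1 k1) ?k1E //= den_k1.
  rewrite {1 2}/D eqxx (negbTE k_neq) mul1r; congr (_ + _).
  rewrite (eq_bigl (fun m : 'I_n => m <= k)%N) => [|m]; last first.
    by rewrite -k1E leE k1E.
  rewrite (bigD1 k) //= den_k1 {1 2}/D eqxx eq_sym (negbTE k_neq) mul1r; congr (_ + _).
  apply: eq_big => m; first by rewrite leE.
  rewrite leE => lt_mk; rewrite den_k1 {1 2}/D [k == m]eq_sym lt_neq //.
  by rewrite [k1 == m]eq_sym lt_neq // k1E ltnW.
have tp_fix (m : 'I_n) : (m < k)%N -> tperm k k1 m = m.
  move=> lt_mk; rewrite tpermD // eq_sym lt_neq // k1E ltnW //.
set y := [ffun i => x (tperm k k1 i)].
have yk : y k = x k1 by rewrite ffunE tpermL.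
have yE (m : 'I_n) : (m < k)%N -> y m = x m by move=> /tp_fix m_fix; rewrite ffunE m_fix.
have low_y (m : 'I_n) : (m < k)%N -> low y m = low x m.
  by move=> lt_mk; apply: eq_bigr => j lt_jk; rewrite /D !yE.
have low_yk : low y k = low x k1.
  apply: eq_bigr => j lt_jk; have lt_jk1 : (j < k1)%N by rewrite k1E ltnW.
  by rewrite /D (lt_neq j k) // (lt_neq j k1) // (yE j) // yk.
have low_neq0 m : low x m != 0.
  apply/prodf_neq0 => j _; rewrite /D; case: (eqVneq j m) => [_ | jm].
    by rewrite oner_eq0.
  by rewrite x_neq // eq_sym.
rewrite newton_k1 !newton_k yk.
have -> : \sum_(m < n | (m < k)%N) f (y m) / ((y m - x k1) * low y m)
    = \sum_(m < n | (m < k)%N) f (x m) / ((x m - x k) * low x m)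
    - (x k - x k1)
      * \sum_(m < n | (m < k)%N) f (x m) / ((x m - x k1) * ((x m - x k) * low x m)).
  rewrite mulr_sumr -sumrB; apply: eq_bigr => m lt_mk; rewrite yE // low_y //.
  have xmk : x m - x k != 0 by rewrite x_neq // lt_neq.
  have xmk1 : x m - x k1 != 0 by rewrite x_neq // lt_neq // k1E ltnW.
  by field; rewrite low_neq0 xmk xmk1.
rewrite low_yk.
have := low_neq0 k; have := low_neq0 k1; have := x_neq _ _ k_neq.
have : x k1 - x k != 0 by rewrite x_neq // eq_sym.
move: (low x k) (low x k1) => A B *.
by field; do ?(apply/andP; split).
Qed.

Lemma divdiffs_newton (first : 'I_n) (x : {ffun 'I_n -> F}) :
    first = 0%N :> nat -> injective x ->
  divdiffs (fun y : {ffun 'I_n -> F} => f (y first)) x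
  = \sum_m f (x m) / \prod_(j < n | j != m) (x m - x j).
Proof.
move=> first0 x_inj.
have n_gt0 : (0 < n)%N := leq_ltn_trans (leq0n first) (ltn_ord first).
have -> : \sum_m f (x m) / \prod_(j < n | j != m) (x m - x j) = newton_form n.-1 x.
  have le_pred (m : 'I_n) : (m <= n.-1)%N by rewrite -ltnS prednK.
  apply: eq_big => [m | m _]; first by rewrite le_pred.
  congr (_ / _); rewrite big_mkcond; apply: eq_big => j; first by rewrite le_pred.
  by case: eqP.
pose g (y : {ffun 'I_n -> F}) := f (y first).
have g_newton (y : {ffun 'I_n -> F}) : injective y -> g y = newton_form 0 y.
  move=> y_inj; have eq_first (m : 'I_n) : (m <= 0)%N = (m == first).
    by rewrite leqn0 -val_eqE [val first]first0.
  rewrite /newton_form (eq_bigl _ _ eq_first) big_pred1_eq (eq_bigl _ _ eq_first).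
  by rewrite big_pred1_eq eqxx divr1.
(* A divided difference evaluates its argument also at a permuted point, so the
   induction ranges over all injective y. *)
have ks_prefix k : (k < n)%N -> forall y : {ffun 'I_n -> F}, injective y ->
    foldl (fun h (i : 'I_n) => divdiff i h) g
          [seq i : 'I_n <- enum 'I_n | (i < k)%N] y = newton_form k y.
  elim: k => [|k IH] lt_kn y y_inj.
    by rewrite (eq_filter (a2 := pred0)) // filter_pred0 /= g_newton.
  pose i0 := Ordinal (ltnW lt_kn).
  have -> : [seq i : 'I_n <- enum 'I_n | (i < k.+1)%N]
            = rcons [seq i : 'I_n <- enum 'I_n | (i < k)%N] i0.
    apply: (inj_map val_inj); rewrite map_rcons.
    have filter_lt l : (l <= n)%N ->
        [seq val i | i <- [seq i : 'I_n <- enum 'I_n | (i < l)%N]] = iota 0 l.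
      move=> le_ln.
      rewrite -(filter_map val (fun i => i < l)%N) val_enum_ord.
      rewrite -(subnKC le_ln) iotaD filter_cat.
      rewrite (all_filterP _) ?(eq_in_filter (a2 := pred0)) ?filter_pred0 ?cats0 //.
        by move=> i; rewrite mem_iota add0n => /andP[le_li _]; rewrite ltnNge le_li.
      by apply/allP => i; rewrite mem_iota.
    rewrite (filter_lt _ (ltnW lt_kn)) (filter_lt _ (ltnW (ltnW lt_kn))).
    by rewrite -[k.+1]addn1 iotaD cats1.
  rewrite foldl_rcons /= -(divdiff_newton_form (k := i0)) //.
  rewrite /divdiff /permute_vars !IH ?(ltnW lt_kn) //.
  by move=> i j; rewrite !ffunE => /y_inj /perm_inj.
rewrite /divdiffs -ks_prefix ?prednK //; congr (foldl _ _ _ _).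
by apply: eq_filter => i; rewrite -[(i < n.-1)%N]ltnS prednK.
Qed.

End DividedDifferences.

(** * The determinant formula *)

Theorem theorem4p12 (R : realType) (n : nat) (hn : (1 < n)%N)
    (c : R[i]) (u v : {ffun 'I_n -> R[i]}) (f : R[i] -> R[i])
    (hu : forall i j : 'I_n, i != j -> u i - u j != 0)
    (hv : forall i j : 'I_n, i != j -> v i - v j != 0)
    (hvu : forall j k : 'I_n, v j - u k != 0)
    (hvuc : forall j k : 'I_n, v j - u k - c != 0) :
  let first : 'I_n := Ordinal (ltnW hn) in
  Sym c
    (iter n.-1 (one_sub_theta c)
       (fun x : {ffun 'I_n -> R[i]} =>
          (\prod_(j < n | (0 < j)%N) \prod_(k < n) (x j - v k)) * f (x first)))
    u
  = (n.-1)`!%:R * (- c) ^+ n.-1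
    * ((\prod_(i < n) \prod_(k < n) ((v i - u k) * (v i - u k - c)))
       / ((\prod_(i < n) \prod_(j < n | (i < j)%N) (v j - v i))
          * (\prod_(i < n) \prod_(j < n | (i < j)%N) (u i - u j))))
    * \det (\matrix_(j < n, k < n) (1 / ((v j - u k) * (v j - u k - c))))
    * divdiffs (fun x : {ffun 'I_n -> R[i]} => f (x first)) u.
Proof.
case: n hn u v hu hv hvu hvuc => // p hn u v hu hv hvu hvuc first.
have u_inj : injective u.
  by move=> i j uij; apply: contraTeq isT => /hu; rewrite uij subrr eqxx.
have v_inj : injective v.
  by move=> i j vij; apply: contraTeq isT => /hv; rewrite vij subrr eqxx.
have -> : first = ord0 by apply: val_inj.
rewrite (Sym_iter_one_sub_theta c (fun x => \prod_(k < p.+1) (x - v k)) f u_inj).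
rewrite (divdiffs_newton f (first := ord0)) // -!mulrA; congr (_ * _).
rewrite !mulrA [RHS]mulr_sumr; apply: eq_bigr => m _.
rewrite (marked_subset_sum_det u_inj v_inj hvu hvuc m hn) /=.
by rewrite mulrCA !mulrA.
Qed.
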